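(* Let $H$ be a graph, let $G=KB(H)$, and let $q$ be a vertex of $G$ with $d_G(q)=2$. Then $G-\{q\}$ is a biclique graph; that is, there exists a graph $H'$ such that $G-\{q\}=KB(H')$.
   Context: All graphs are finite, simple, undirected and connected. A biclique of a graph $H$ is a maximal (with respect to vertex-set inclusion) set of vertices inducing a complete bipartite subgraph $K_{r,s}$ with $r,s\ge 1$. The biclique graph $KB(H)$ is the intersection graph of the family of all bicliques of $H$: its vertices are the bicliques of $H$, and two bicliques are adjacent iff they share at least one vertex. A graph $G$ is a biclique graph if $G=KB(H)$ (up to isomorphism) for some graph $H$. $d_G(q)$ denotes the degree of $q$ in $G$. *)

(* Defs.v *)
From mathcomp Require Import all_boot.
Set Implicit Arguments. Unset Strict Implicit. Unset Printing Implicit Defensive.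

Definition simple_graph (T : finType) (e : rel T) : Prop :=
  symmetric e /\ irreflexive e.

Definition connected_graph (T : finType) (e : rel T) : Prop :=
  forall x y : T, connect e x y.

Definition induces_Kbip (T : finType) (e : rel T) (B : {set T}) : bool :=
  [exists X : {set T},
    [&& X \subset B, X != set0, (B :\: X) != set0,
        [forall x in X, forall y in X, ~~ e x y],
        [forall x in B :\: X, forall y in B :\: X, ~~ e x y] &
        [forall x in X, forall y in B :\: X, e x y]]].

Definition is_biclique (T : finType) (e : rel T) (B : {set T}) : bool :=
  induces_Kbip e B && [forall B' : {set T}, (B \proper B') ==> ~~ induces_Kbip e B'].

Definition KBvert (T : finType) (e : rel T) : finType :=
  {B : {set T} | is_biclique e B}.

Definition KBrel (T : finType) (e : rel T) : rel (KBvert e) :=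
  fun B1 B2 => (B1 != B2) && ~~ [disjoint val B1 & val B2].

Definition degree (T : finType) (e : rel T) (x : T) : nat :=
  #|[set y | e x y]|.

Definition del_vert (T : finType) (q : T) : finType := {x : T | x != q}.
Definition del_rel (T : finType) (e : rel T) (q : T) : rel (del_vert q) :=
  fun x y => e (val x) (val y).

Definition graph_iso (T1 T2 : finType) (e1 : rel T1) (e2 : rel T2) : Prop :=
  exists f : T1 -> T2, bijective f /\ forall x y, e1 x y = e2 (f x) (f y).

Arguments KBrel {T} e _ _.
Arguments del_rel {T} e q _ _.
Arguments degree {T} e x.

(* Main.v *)
Require Import Defs.
From mathcomp Require Import all_boot.

(** Let Q be the deleted biclique of H and Q1, Q2 the only two bicliques that
    meet it.
    - If Q1 contains Q :&: Q2 (or symmetrically), the vertices of Q :\: Q1 lie in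
      no other biclique, and deleting them from H absorbs Q into Q1.
    - Otherwise, suppose that some vertex u of Q1 :|: Q2 outside Q has no
      neighbour in Q.  Then H is rigid around Q: there are classes X, Y, W, U
      with Q = (X | Y), Q1 = (X :|: U | W) and Q2 = (Y :|: U | W), the edges
      leaving X :|: Y all go to W, and those leaving W go to X, Y and U.
      Deleting the edges between X and Y and adding one vertex, adjacent to
      X :|: U, kills Q and keeps Q1 and Q2 distinct.
    - In the remaining case Q, Q1 and Q2 are the only bicliques, so the result
      is K_2, the biclique graph of the path on four vertices. *)

Set Implicit Arguments.
Unset Strict Implicit.
Unset Printing Implicit Defensive.

(* Induced complete bipartite subgraphs without naming the two sides: given an
   edge xy, every vertex z is adjacent to exactly one of x and y. *)
Definition bisplit (T : finType) (e : rel T) (B : {set T}) : Prop :=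
  (exists x y, [/\ x \in B, y \in B & e x y]) /\
  {in B & &, forall x y z, e x y -> e x z (+) e y z}.

(** The exclusive-or condition mentions vertices only through adjacency, so it pulls back along any
    map that preserves and reflects adjacency, injective or not. Only the existence of an edge has
    to be supplied. Maps that merge twins are the main use. *)
Lemma bisplit_pullback (T T' : finType) (e : rel T) (e' : rel T')
    (h : T' -> T) (B : {set T}) (B' : {set T'}) :
  bisplit e B -> {in B', forall x, h x \in B} ->
  {in B' &, forall x y, e' x y = e (h x) (h y)} ->
  (exists x y, [/\ x \in B', y \in B' & e' x y]) -> bisplit e' B'.
Proof.
move=> [_ hB] hh he hex; split=> // x y z xB yB zB.
by rewrite !he //; apply: hB; apply: hh.
Qed.

(** * Bicliques as maximal [bisplit] sets *)

Section Bicliques.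
Variables (T : finType) (e : rel T).
Hypotheses (esym : symmetric e) (eirr : irreflexive e).
Implicit Types B C : {set T}.

Lemma induces_KbipP B : reflect (bisplit e B) (induces_Kbip e B).
Proof.
apply: (iffP existsP) => [[X /and5P[sXB X0 Y0 iX /andP[iY cXY]]]|].
  have eE x y : x \in B -> y \in B -> e x y = (x \in X) (+) (y \in X).
    move=> xB yB; case xX: (x \in X); case yX: (y \in X) => /=.
    - by apply/negbTE; move/forall_inP/(_ _ xX)/forall_inP/(_ _ yX): iX.
    - by move/forall_inP/(_ _ xX)/forall_inP/(_ y): cXY; rewrite !inE yX; apply.
    - rewrite esym.
      by move/forall_inP/(_ _ yX)/forall_inP/(_ x): cXY; rewrite !inE xX; apply.
    - apply/negbTE; move/forall_inP/(_ x): iY; rewrite !inE xX => /(_ xB).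
      by move/forall_inP/(_ y); rewrite !inE yX; apply.
  have [[x xX] [y]] := (set0Pn _ X0, set0Pn _ Y0); rewrite inE => /andP[yX yB].
  have xB := subsetP sXB _ xX.
  split=> [|u v z uB vB zB]; first by exists x, y; rewrite eE // xX (negbTE yX).
  by rewrite !eE //; case: (u \in X); case: (v \in X); case: (z \in X).
(* The two sides are read off the edge [x y]: one is the neighbourhood of [y] in [B], and by the
   exclusive-or condition its complement in [B] is the neighbourhood of [x]. *)
case=> [[x [y [xB yB exy]]] hB]; exists [set z in B | e y z].
have nX z : z \in B -> z \in B :\: [set z in B | e y z] = e x z.
  move=> zB; rewrite !inE zB /= andbT; move: (hB x y z xB yB zB exy).
  by case: (e x z); case: (e y z).
apply/and5P; split.
- by apply/subsetP=> z; rewrite inE => /andP[].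
- by apply/set0Pn; exists x; rewrite inE xB esym.
- by apply/set0Pn; exists y; rewrite nX.
- apply/forall_inP=> u; rewrite inE => /andP[uB eu].
  apply/forall_inP=> v; rewrite inE => /andP[vB ev].
  by move: (hB _ _ _ yB uB vB eu); rewrite ev; case: (e u v).
apply/andP; split; apply/forall_inP=> u uX; apply/forall_inP=> v vX.
  have [/setDP[uB _] /setDP[vB _]] := (uX, vX).
  move: uX vX; rewrite !nX // => eu ev.
  by move: (hB _ _ _ xB uB vB eu); rewrite ev; case: (e u v).
move: uX; rewrite inE => /andP[uB eu]; have vB : v \in B by case/setDP: vX.
move: vX; rewrite nX // => ev; rewrite esym in eu.
move: (hB _ _ _ uB yB vB eu) (hB _ _ _ xB yB vB exy); rewrite ev.
by case: (e u v); case: (e y v).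
Qed.

Lemma biclique_bisplit B : is_biclique e B -> bisplit e B.
Proof. by case/andP=> /induces_KbipP. Qed.

Lemma biclique_max B C : is_biclique e B -> bisplit e C -> B \subset C -> B = C.
Proof.
case/andP=> _ /forallP/(_ C) mB /induces_KbipP kC sBC; apply/eqP.
by move: mB; rewrite properEneq sBC kC andbT implybF negbK.
Qed.

Lemma biclique_sub B C :
  is_biclique e B -> is_biclique e C -> B \subset C -> B = C.
Proof. by move=> bB /biclique_bisplit; apply: biclique_max. Qed.

Lemma biclique_exists C :
  bisplit e C -> exists2 B, is_biclique e B & C \subset B.
Proof.
move/induces_KbipP=> kC; have [B /maxsetP[kB mB] sCB] := maxset_exists kC.
exists B => //; apply/andP; split=> //; apply/forallP=> D; apply/implyP=> pBD.
by apply/negP=> kD; move: (pBD); rewrite (mB D) ?properxx // proper_sub.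
Qed.

(** Mapping [w'] to [w] shows that [w' |: B] is still [bisplit], so maximality of [B] forces [w']
    into it. *)
Lemma biclique_twin B w w' : is_biclique e B -> w \in B ->
  {in B, forall v, e w v = e w' v} -> w' \in B.
Proof.
move=> bB wB tw; have [[x [y [xB yB exy]]] hB] := biclique_bisplit bB.
suff -> : B = w' |: B by rewrite setU11.
apply: (biclique_max bB) (subsetUr _ _).
have hw v : v \in w' |: B -> e w v = e w' v.
  by case/setU1P=> [->|/tw //]; rewrite eirr esym -tw // eirr.
apply: (bisplit_pullback (h := fun v => if v == w' then w else v)
  (biclique_bisplit bB)).
- by move=> v /setU1P[->|vB]; [rewrite eqxx | case: ifP].
- move=> u v uB vB; case: eqP => [->|_]; case: eqP => [->|_] //.
  + by rewrite !eirr.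
  + by rewrite hw.
  + by rewrite esym [RHS]esym hw.
- by exists x, y; rewrite !inE xB yB !orbT.
Qed.

(** The case [z = x] is allowed and useful: it puts a single edge into a biclique. *)
Lemma p3_biclique x y z : e x y -> e y z -> ~~ e x z ->
  exists B, [/\ is_biclique e B, x \in B, y \in B & z \in B].
Proof.
move=> exy eyz /negbTE exz.
have [|B bB /subsetP sB] := @biclique_exists [set x; y; z].
  split; first by exists x, y; rewrite !inE !eqxx ?orbT.
  have [eyx ezy ezx] : [/\ e y x, e z y & e z x = false].
    by split; rewrite // esym.
  move=> a b c; rewrite !inE -!orbA.
  by do 3![case/or3P => /eqP->]; rewrite ?(eirr, exy, eyz, exz, eyx, ezy, ezx).
by exists B; split=> //; apply: sB; rewrite !inE eqxx ?orbT.
Qed.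

Section Inside.
Variable B : {set T}.
Hypothesis bB : is_biclique e B.

Lemma bic_xor x y z :
  x \in B -> y \in B -> z \in B -> e x y -> e x z (+) e y z.
Proof. by case: (biclique_bisplit bB) => _; apply. Qed.

Lemma bic_adj x y z :
  x \in B -> y \in B -> z \in B -> e x y -> ~~ e x z -> e y z.
Proof.
by move=> xB yB zB /(bic_xor xB yB zB) h /negbTE exz; rewrite exz in h.
Qed.

Lemma bic_nadj x y z :
  x \in B -> y \in B -> z \in B -> e x y -> e x z -> ~~ e y z.
Proof.
by move=> xB yB zB /(bic_xor xB yB zB) h exz; rewrite exz in h.
Qed.

Lemma bic_neighbor x : x \in B -> exists2 y, y \in B & e x y.
Proof.
move=> xB; have [[u [v [uB vB euv]]] _] := biclique_bisplit bB.
case eux: (e u x); first by exists u; rewrite // esym.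
by exists v => //; rewrite esym; apply: bic_adj euv _; rewrite ?eux.
Qed.

(** A complete bipartite graph is connected: if [x] and [y] are not adjacent they share a neighbour
    [t] in [B], and one of the edges at [t] crosses the boundary of [C]. *)
Lemma bic_crossing (C : {set T}) x y :
  x \in B -> y \in B -> x \in C -> y \notin C ->
  exists u v, [/\ u \in B, v \in B, u \in C, v \notin C & e u v].
Proof.
move=> xB yB xC yC; case exy: (e x y); first by exists x, y.
have [t tB ext] := bic_neighbor xB.
have ety : e t y by apply: bic_adj ext _; rewrite ?exy.
by case tC: (t \in C); [exists t, y | exists x, t; rewrite tC].
Qed.

Lemma bic_neq_sub C : is_biclique e C -> B <> C ->
  exists2 x, x \in B & x \notin C.
Proof.
by move=> bC neq; apply/subsetPn/negP=> /(biclique_sub bB bC).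
Qed.

End Inside.

End Bicliques.

(** * Transporting biclique graphs and connectedness *)

(** Maximality of [phi B] need not be checked by hand. A biclique [K] containing [phi B] lies in
    some [phi C]; since inclusion of images forces equality, [C = B] and [phi B = K]. *)
Lemma graph_iso_biclique_map (T T' : finType) (e : rel T) (e' : rel T')
    (q : KBvert e) (phi : {set T} -> {set T'}) :
  symmetric e' ->
  let other B := is_biclique e B /\ B <> val q in
  (forall B, other B -> bisplit e' (phi B)) ->
  (forall K, is_biclique e' K -> exists2 B, other B & K \subset phi B) ->
  (forall B C, other B -> other C -> phi B \subset phi C -> B = C) ->
  (forall B C, other B -> other C -> B <> C ->
     [disjoint phi B & phi C] = [disjoint B & C]) ->
  graph_iso (del_rel (KBrel e) q) (KBrel e').
Proof.
move=> es' other hphi hsurj hinj hdis.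
have oth (x : del_vert q) : other (val (val x)).
  split; first exact: (valP (val x)).
  by move/val_inj/eqP; apply/negP/(valP x).
have phiB B : other B -> is_biclique e' (phi B).
  move=> oB; have [K bK sK] := biclique_exists es' (hphi B oB).
  have [C oC sC] := hsurj K bK.
  have eBC : B = C by apply: hinj => //; apply: subset_trans sC.
  suff -> : phi B = K by [].
  by apply/eqP; rewrite eqEsubset sK eBC.
pose f (x : del_vert q) : KBvert e' := Sub (phi (val (val x))) (phiB _ (oth x)).
have fE x : val (f x) = phi (val (val x)) by [].
have finj : injective f.
  move=> x y /(congr1 val); rewrite !fE => exy; apply/val_inj/val_inj.
  by apply: hinj; rewrite ?exy.
have fsurj (K : KBvert e') : exists x, f x = K.
  have [B oB sB] := hsurj _ (valP K).
  have [bB nB] := oB; pose Bq : KBvert e := Sub B bB.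
  have nBq : Bq != q by apply/eqP=> eq; apply: nB; rewrite -eq.
  exists (Sub Bq nBq : del_vert q); apply/val_inj; apply/esym.
  exact: (biclique_sub es' (valP K) (phiB _ oB) sB).
have [g gK] := fin_all_exists fsurj.
exists f; split; first by exists g => // x; apply: finj; rewrite gK.
move=> x y; rewrite /del_rel /KBrel (inj_eq finj) (inj_eq val_inj).
case: eqVneq => //= nxy; rewrite (hdis _ _ (oth x) (oth y)) //.
by move/val_inj/val_inj/eqP; apply/negP.
Qed.

Lemma connected_transport (T T' : finType) (e : rel T) (e' : rel T')
    (h : T -> T') :
  (forall x y, e x y -> connect e' (h x) (h y)) ->
  connected_graph e -> forall x y, connect e' (h x) (h y).
Proof.
move=> eh ce x y; have /connectP[p] := ce x y.
elim: p x => [|z p IHp] x /=; first by move=> _ ->.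
by case/andP=> exz pz ly; apply: connect_trans (eh _ _ exz) (IHp _ pz ly).
Qed.

(** * Absorbing [Q] into [Q1] by deleting vertices *)

Section DeletePrivate.
Variables (T : finType) (e : rel T) (q : KBvert e) (Q1 : {set T}).
Hypotheses (esym : symmetric e) (eirr : irreflexive e).
Hypothesis ce : connected_graph e.
Hypotheses (bQ1 : is_biclique e Q1) (nQ1 : Q1 <> val q).
Hypothesis sQ1 : forall B v, is_biclique e B -> B <> val q ->
  v \in B -> v \in val q -> v \in Q1.

(** The vertices of [P] lie in no biclique except [Q], so every other biclique survives unchanged.
    What remains of [Q] lies in [Q1], so it is no longer a separate biclique. *)
Lemma delete_private :
  exists (T' : finType) (e' : rel T'),
    simple_graph e' /\ connected_graph e' /\
    graph_iso (del_rel (KBrel e) q) (KBrel e').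
Proof.
pose P := val q :\: Q1; pose T' : finType := {x : T | x \notin P}.
pose e' : rel T' := fun x y => e (val x) (val y).
have es' : symmetric e' by move=> x y; apply: esym.
have kQ1 x : x \in Q1 -> x \notin P by move=> xQ1; rewrite inE xQ1.
have other_notP B x : is_biclique e B /\ B <> val q -> x \in B -> x \notin P.
  move=> [bB nB] xB; rewrite inE; case xq: (x \in val q); last by rewrite andbF.
  by rewrite (sQ1 bB nB xB xq).
have [c cQ1] : exists c, c \in Q1.
  by have [[c [_ [cQ1 _ _]]] _] := biclique_bisplit esym bQ1; exists c.
(* A retraction onto the remaining vertices: every deleted vertex goes to the default value [c], a
   vertex of [Q1]. It serves to push walks of the old graph into the new one. *)
pose h x : T' := insubd (Sub c (kQ1 c cQ1)) x.
have hK x : x \notin P -> val (h x) = x by move=> xP; rewrite insubdK.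
have hV (x : T') : h (val x) = x by apply: valKd.
have conn_Q1 x y : x \in Q1 -> y \in Q1 -> connect e' (h x) (h y).
  move=> xQ yQ; case exy: (e x y).
    by apply: connect1; rewrite /e' !hK ?kQ1.
  have [z zQ exz] := bic_neighbor esym bQ1 xQ.
  apply: (@connect_trans _ _ (h z)); apply: connect1; rewrite /e' !hK ?kQ1 //.
  by apply: (bic_adj esym bQ1 xQ zQ yQ exz); rewrite exy.
have hP x : x \in P -> h x = h c.
  by move=> xP; apply: val_inj; rewrite (hK c) ?kQ1 // /h val_insubd xP.
(* An edge at a deleted vertex lies in a biclique that must be [Q]; its other end, if kept, is
   therefore in [Q1], which is connected and survives. *)
have PQ1 x y : e x y -> x \in P -> y \notin P -> y \in Q1.
  move=> exy xP yP.
  have [B [bB xB yB _]] : exists B, [/\ is_biclique e B, x \in B, y \in B & x \in B].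
    by apply: p3_biclique; rewrite // ?eirr // esym.
  have [Bq|nB] := eqVneq B (val q); last first.
    by case/negP: (other_notP B x (conj bB (elimN eqP nB)) xB).
  by move: yP; rewrite inE -Bq yB andbT negbK.
have esym_conn := sym_connect_sym es'.
exists T', e'; split; [by split=> // x; apply: eirr | split].
  move=> x y; rewrite -(hV x) -(hV y).
  apply: connected_transport ce _ _ => {x y} x y exy.
  have [xP|xP] := boolP (x \in P); have [yP|yP] := boolP (y \in P).
  - by rewrite !hP.
  - by rewrite (hP x) //; apply: conn_Q1 => //; apply: PQ1 exy xP yP.
  - rewrite (hP y) // esym_conn; apply: conn_Q1 => //.
    by apply: PQ1 yP xP; rewrite esym.
  - by apply: connect1; rewrite /e' !hK.
apply: (graph_iso_biclique_map (phi := fun B => [set x : T' | val x \in B])) => //.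
- move=> B [bB nB]; have kB := other_notP B _ (conj bB nB).
  apply: (bisplit_pullback (h := val) (biclique_bisplit esym bB)) => //.
    by move=> x; rewrite inE.
  have [[x [y [xB yB exy]]] _] := biclique_bisplit esym bB.
  by exists (h x), (h y); rewrite /e' !inE !hK ?kB.
- move=> K bK; pose K0 := [set val x | x in K].
  have [|B bB sB] := @biclique_exists _ _ esym K0.
    have [[x [y [xK yK exy]]] _] := biclique_bisplit es' bK.
    apply: (bisplit_pullback (h := h) (biclique_bisplit es' bK)).
    + by move=> _ /imsetP[x' x'K ->]; rewrite hV.
    + by move=> _ _ /imsetP[? _ ->] /imsetP[? _ ->]; rewrite !hV.
    + by exists (val x), (val y); split=> //; apply: imset_f.
  have KB x : x \in K -> val x \in B.
    by move=> xK; apply: (subsetP sB); apply: imset_f.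
  (* The extension [B] of [K] in the old graph can be [Q] itself; then [K], which avoids [P], lies
     in [Q1]. *)
  have [Bq|/eqP nB] := eqVneq B (val q); last first.
    by exists B => //; apply/subsetP=> x /KB; rewrite inE.
  exists Q1 => //; apply/subsetP=> x /KB; rewrite inE Bq => xq.
  by have := valP x; rewrite inE xq andbT negbK.
- move=> B C [bB nB] [bC nC] /subsetP sBC; apply: (biclique_sub esym bB bC).
  apply/subsetP=> x xB; have xP := other_notP B x (conj bB nB) xB.
  by have := sBC (h x); rewrite !inE hK //; apply.
move=> B C oB oC _; apply/idP/idP; rewrite -!setI_eq0 => /eqP/setP dBC.
  apply/eqP/setP=> x; rewrite !inE; apply/negP=> /andP[xB xC].
  by have := dBC (h x); rewrite !inE hK ?xB ?xC //; apply: other_notP xB.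
by apply/eqP/setP=> x; have := dBC (val x); rewrite !inE.
Qed.
End DeletePrivate.

(** * The path on four vertices, whose biclique graph is [K_2] *)

Definition p4_rel : rel 'I_4 := fun x y => (x.+1 == y) || (y.+1 == x).

Lemma p4_sym : symmetric p4_rel.
Proof. by move=> x y; rewrite /p4_rel orbC. Qed.

Lemma p4_irr : irreflexive p4_rel.
Proof. by move=> x; rewrite /p4_rel orbb gtn_eqF. Qed.

Lemma p4_connected : connected_graph p4_rel.
Proof.
have c0 (x : 'I_4) : connect p4_rel ord0 x.
  case: x => n; elim: n => [|n IHn] hn; first by apply: eq_connect0; apply: val_inj.
  apply: connect_trans (IHn (ltnW hn)) (connect1 _).
  by rewrite /p4_rel /= eqxx.
move=> x y; apply: connect_trans (c0 y).
by rewrite (sym_connect_sym p4_sym).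
Qed.

Lemma p4_bisplit (z : 'I_4) : (z == ord0) || (z == ord_max) ->
  bisplit p4_rel [set~ z].
Proof.
move=> hz; split.
  exists (inord 1), (inord 2); rewrite !inE -!val_eqE /p4_rel /= !inordK //.
  by split=> //; case/orP: hz => /eqP->.
move=> x y t; rewrite !inE => xz yz tz.
rewrite /p4_rel; move: hz xz yz tz; rewrite -!val_eqE.
case: z => [[|[|[|[|?]]]] ?] //=; case: x => [[|[|[|[|?]]]] ?] //=;
  case: y => [[|[|[|[|?]]]] ?] //=; by case: t => [[|[|[|[|?]]]] ?].
Qed.

(** No biclique contains both ends: the only neighbour of [ord0] is 1, and [ord_max] is adjacent to
    neither of these two. *)
Lemma p4_biclique_sub K : is_biclique p4_rel K ->
  K \subset [set~ ord0] \/ K \subset [set~ ord_max].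
Proof.
move=> bK; have sub z : z \notin K -> K \subset [set~ z].
  by move=> zK; rewrite subsetC sub1set inE.
have [k0|/sub] := boolP (ord0 \in K); last by left.
have [k3|/sub] := boolP (ord_max \in K); last by right.
have [y yK ey] := bic_neighbor p4_sym bK k0.
have := bic_xor p4_sym bK k0 yK k3 ey.
by case: y ey {yK} => [[|[|[|[|?]]]] ?].
Qed.

Lemma two_other_bicliques (T : finType) (e : rel T) (q : KBvert e)
    (Q1 Q2 : {set T}) : symmetric e ->
  is_biclique e Q1 -> is_biclique e Q2 -> Q1 <> val q -> Q2 <> val q ->
  Q1 <> Q2 -> ~~ [disjoint Q1 & Q2] ->
  (forall B, is_biclique e B -> [\/ B = val q, B = Q1 | B = Q2]) ->
  graph_iso (del_rel (KBrel e) q) (KBrel p4_rel).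
Proof.
move=> es b1 b2 n1 n2 n12 d12 all3.
(* [z B] is the end of the path that the image of [B] omits: [Q1] goes to 1, 2, 3 and [Q2] to 0, 1,
   2. These images share the vertex 1, matching the assumption that [Q1] meets [Q2]. *)
pose z B : 'I_4 := if B == Q1 then ord0 else ord_max.
have hz B : (z B == ord0) || (z B == ord_max).
  by rewrite /z; case: ifP => _; rewrite eqxx ?orbT.
have n21 : (Q2 == Q1) = false by apply/eqP=> h; apply: n12.
have zinj B C : is_biclique e B -> is_biclique e C -> B <> val q ->
    C <> val q -> z B = z C -> B = C.
  move=> bB bC nB nC; rewrite /z.
  by case: (all3 B bB) => // ->; case: (all3 C bC) => // ->;
    rewrite ?eqxx ?n21 // => /eqP.
apply: (graph_iso_biclique_map (phi := fun B => [set~ z B])) p4_sym _ _ _ _.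
- by move=> B _; apply: p4_bisplit.
- move=> K /p4_biclique_sub[sK|sK]; [exists Q1 | exists Q2] => //.
    by rewrite /z eqxx.
  by rewrite /z n21.
- move=> B C [bB nB] [bC nC]; rewrite setCS sub1set inE => /eqP h.
  by apply: zinj.
move=> B C [bB nB] [bC nC] nBC; have -> : [disjoint B & C] = false.
  case: (all3 B bB) nBC => // ->; case: (all3 C bC) => // -> // _.
    exact: negbTE.
  by rewrite disjoint_sym; apply: negbTE.
apply/negbTE; rewrite -setI_eq0; apply/set0Pn; exists (inord 1).
by rewrite !inE /z; do 2![case: ifP => _]; rewrite -!val_eqE /= inordK.
Qed.

(** * Structure around a biclique that only two others meet *)

Definition only_meets (T : finType) (e : rel T) (Q Q1 Q2 : {set T}) : Prop :=
  forall B v, is_biclique e B -> v \in B -> v \in Q ->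
  [\/ B = Q, B = Q1 | B = Q2].

Lemma only_meets_sym (T : finType) (e : rel T) (Q Q1 Q2 : {set T}) :
  only_meets e Q Q1 Q2 -> only_meets e Q Q2 Q1.
Proof.
move=> oQ B v bB vB vQ.
by case: (oQ B v bB vB vQ); [constructor 1 | constructor 3 | constructor 2].
Qed.

Section LocalStructure.
Variables (T : finType) (e : rel T).
Hypotheses (esym : symmetric e) (eirr : irreflexive e).

(** The main tool of the local analysis. An induced path on three vertices that meets [Q] lies in
    [Q], [Q1] or [Q2], so a path missing a vertex of each is contradictory, and its two ends must in
    fact be adjacent. *)
Lemma p3_meets Q Q1 Q2 x y z : only_meets e Q Q1 Q2 ->
  e x y -> e y z -> ~~ e x z -> [|| x \in Q, y \in Q | z \in Q] ->
  [|| [&& x \in Q, y \in Q & z \in Q], [&& x \in Q1, y \in Q1 & z \in Q1]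
    | [&& x \in Q2, y \in Q2 & z \in Q2]].
Proof.
move=> oQ exy eyz exz hQ.
have [B [bB xB yB zB]] := p3_biclique esym eirr exy eyz exz.
have [v vB vQ] : exists2 v, v \in B & v \in Q.
  by case/or3P: hQ => ?; [exists x | exists y | exists z].
by case: (oQ B v bB vB vQ) => <-; rewrite xB yB zB ?orbT.
Qed.

Lemma edge_meets Q Q1 Q2 x y : only_meets e Q Q1 Q2 ->
  e x y -> x \in Q -> y \notin Q ->
  (x \in Q1) && (y \in Q1) || (x \in Q2) && (y \in Q2).
Proof.
move=> oQ exy xQ /negbTE yQ; have eyx : e y x by rewrite esym.
have := p3_meets oQ exy eyx; rewrite eirr xQ yQ => /(_ isT isT) /=.
by case/orP => /and3P[-> -> _]; rewrite ?orbT.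
Qed.

Section Half.
Variables (Q Q1 Q2 : {set T}) (a u : T).
Hypotheses (bQ : is_biclique e Q) (bQ1 : is_biclique e Q1)
  (bQ2 : is_biclique e Q2) (oQ : only_meets e Q Q1 Q2).
Hypotheses (aQ : a \in Q) (aQ1 : a \in Q1) (aQ2 : a \notin Q2).
Hypotheses (uQ1 : u \in Q1) (uQ : u \notin Q).
Hypothesis uN : {in Q, forall v, ~~ e u v}.

(** Since [u] has no neighbour in [Q], it is on the side of [a] in [Q1]. Hence the neighbours of [a]
    in [Q1] lie outside [Q], and its neighbours in [Q] lie outside [Q1]. All the rest comes from
    paths through one [w] of the first kind and one [y] of the second. *)
Lemma isolated_half :
  [/\ u \in Q2,
      forall v, v \in Q1 -> v \notin Q -> v \in Q2,
      {in Q, forall v, (v \in Q1) = ~~ e a v /\ (v \in Q2) = e a v} &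
      forall w, w \in Q1 -> e a w ->
        [/\ w \notin Q, w \in Q2 & {in Q, forall v, e w v}]].
Proof.
have hwu w : w \in Q1 -> e a w -> e w u.
  by move=> wQ1 eaw; apply: (bic_adj esym bQ1 aQ1 wQ1 uQ1 eaw); rewrite esym uN.
have hwQ w : w \in Q1 -> e a w -> w \notin Q.
  move=> wQ1 eaw; apply/negP=> wQ; have := hwu w wQ1 eaw.
  by rewrite esym (negbTE (uN wQ)).
have yQ1 y : y \in Q -> e a y -> y \notin Q1.
  move=> yQ eay; apply/negP=> yQ1; have := hwu y yQ1 eay.
  by rewrite esym (negbTE (uN yQ)).
(* Otherwise [w a y] would be an induced path with [w] outside [Q], [y] outside [Q1] and [a] outside
   [Q2]. *)
have hwy w y : w \in Q1 -> e a w -> y \in Q -> e a y -> e w y.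
  move=> wQ1 eaw yQ eay; apply: contraT => newy.
  have ewa : e w a by rewrite esym.
  have := p3_meets oQ ewa eay newy; rewrite aQ orbT => /(_ isT).
  by rewrite (negbTE (hwQ _ wQ1 eaw)) (negbTE aQ2) (negbTE (yQ1 _ yQ eay)) !andbF.
have hwyQ2 w y : w \in Q1 -> e a w -> y \in Q -> e a y -> (w \in Q2) && (y \in Q2).
  move=> wQ1 eaw yQ eay; have ewy := hwy w y wQ1 eaw yQ eay.
  have eyw : e y w by rewrite esym.
  have := edge_meets oQ eyw yQ (hwQ _ wQ1 eaw).
  by rewrite (negbTE (yQ1 _ yQ eay)) /= andbC.
have [w wQ1 eaw] := bic_neighbor esym bQ1 aQ1.
have [y yQ eay] := bic_neighbor esym bQ aQ.
have /andP[wQ2 yQ2] := hwyQ2 w y wQ1 eaw yQ eay.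
have uQ2 : u \in Q2.
  have euw : e u w by rewrite esym hwu.
  have := p3_meets oQ euw (hwy w y wQ1 eaw yQ eay) (uN yQ).
  rewrite yQ !orbT (negbTE uQ) (negbTE (yQ1 _ yQ eay)) !andbF /= => /(_ isT).
  by case/andP.
(* If [x] and [w'] were not adjacent, the path [x y w'] would put [x] into [Q2] next to [y] and [u].
   But [u] is adjacent to neither end of the edge [x y]. *)
have hx x w' : x \in Q -> ~~ e a x -> w' \in Q1 -> e a w' -> e w' x.
  move=> xQ neax w'Q1 eaw'; rewrite esym; apply: contraT => nexw.
  have exy : e x y by rewrite esym; apply: (bic_adj esym bQ aQ yQ xQ eay).
  have eyw : e y w' by rewrite esym hwy.
  have := p3_meets oQ exy eyw nexw; rewrite xQ (negbTE (hwQ _ w'Q1 eaw')).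
  rewrite (negbTE (yQ1 _ yQ eay)) !andbF /= => /(_ isT) /and3P[xQ2 _ _].
  have := bic_xor esym bQ2 xQ2 yQ2 uQ2 exy.
  by rewrite esym (negbTE (uN xQ)) esym (negbTE (uN yQ)).
split=> //.
- move=> v vQ1 vQ; case eav: (e a v).
    by case/andP: (hwyQ2 v y vQ1 eav yQ eay).
  have evw : e v w.
    by rewrite esym; apply: (bic_adj esym bQ1 aQ1 wQ1 vQ1 eaw); rewrite eav.
  case eyv: (e y v).
    have := edge_meets oQ eyv yQ vQ.
    by rewrite (negbTE (yQ1 _ yQ eay)) => /andP[].
  have := p3_meets oQ evw (hwy w y wQ1 eaw yQ eay).
  rewrite esym eyv yQ (negbTE vQ) (negbTE (yQ1 _ yQ eay)) !orbT !andbF /=.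
  by move=> /(_ isT isT) /andP[].
- move=> v vQ; case eav: (e a v).
    by rewrite (negbTE (yQ1 v vQ eav)); case/andP: (hwyQ2 w v wQ1 eaw vQ eav).
  have ewv : e w v by apply: hx; rewrite ?eav.
  have evw : e v w by rewrite esym.
  have eyv : e y v by apply: (bic_adj esym bQ aQ yQ vQ eay); rewrite eav.
  have vQ2 : v \notin Q2.
    apply/negP=> vQ2; have := bic_xor esym bQ2 wQ2 yQ2 vQ2 (hwy w y wQ1 eaw yQ eay).
    by rewrite ewv eyv.
  have := edge_meets oQ evw vQ (hwQ _ wQ1 eaw).
  by rewrite (negbTE vQ2) orbF => /andP[-> _].
- move=> w' w'Q1 eaw'; split; first exact: hwQ.
    by case/andP: (hwyQ2 w' y w'Q1 eaw' yQ eay).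
  move=> v vQ; case eav: (e a v); first exact: hwy.
  by apply: hx; rewrite ?eav.
Qed.

End Half.

(** [isolated_half] applies twice, from [a] in [Q1] and from [b] in [Q2], because its first use puts
    [u] into [Q2]. In the notation X, Y, W, U, the set X is [Q :&: Q1], Y is [Q :&: Q2], and U is
    what remains of [Q1] outside [Q] and [W]. *)
Lemma isolated_structure (Q Q1 Q2 : {set T}) (a b u : T) :
  is_biclique e Q -> is_biclique e Q1 -> is_biclique e Q2 ->
  only_meets e Q Q1 Q2 ->
  a \in Q -> a \in Q1 -> a \notin Q2 -> b \in Q -> b \in Q2 -> b \notin Q1 ->
  u \in Q1 -> u \notin Q -> {in Q, forall v, ~~ e u v} ->
  exists W : {set T},
  [/\ [/\ W != set0, W \subset Q1 & [disjoint W & Q]],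
      forall v, (v \in Q2) = if v \in Q then v \notin Q1 else v \in Q1,
      {in Q &, forall v v', e v v' = (v \in Q1) (+) (v' \in Q1)},
      {in Q, forall v w, w \notin Q -> e v w = (w \in W)} &
      {in W, forall w n, n \notin Q -> e w n = (n \in Q1) && (n \notin W)}].
Proof.
move=> bQ bQ1 bQ2 oQ aQ aQ1 aQ2 bQ' bQ2' bQ1' uQ1 uQ uN.
have [uQ2 h12 hv hw] := isolated_half bQ bQ1 bQ2 oQ aQ aQ1 aQ2 uQ1 uQ uN.
have [_ h21 hv' hw'] := isolated_half bQ bQ2 bQ1 (only_meets_sym oQ)
  bQ' bQ2' bQ1' uQ2 uQ uN.
have hQ v : v \in Q -> (v \in Q2) = (v \notin Q1).
  by move=> vQ; have [-> ->] := hv v vQ; rewrite negbK.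
(* The side opposite [a] in [Q1] and the side opposite [b] in [Q2] are the same set, so [W] does not
   depend on the choice. *)
have hW w : (w \in Q1) && e a w = (w \in Q2) && e b w.
  apply/andP/andP=> -[wi ew].
    by have [_ w2 wN] := hw w wi ew; rewrite esym wN.
  by have [_ w2 wN] := hw' w wi ew; rewrite esym wN.
pose W := [set w in Q1 | e a w].
have WE w : (w \in W) = (w \in Q1) && e a w by rewrite inE.
have [w0 w0Q1 eaw0] := bic_neighbor esym bQ1 aQ1.
have w0W : w0 \in W by rewrite WE w0Q1.
have [w0Q w0Q2 w0N] := hw w0 w0Q1 eaw0.
have eNW v w : v \in Q -> w \notin Q -> e v w = (w \in W).
  move=> vQ wQ; apply/idP/idP=> [evw|]; last first.
    by rewrite WE => /andP[wQ1 eaw]; rewrite esym; have [_ _] := hw w wQ1 eaw; apply.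
  have := edge_meets oQ evw vQ wQ; rewrite WE.
  have [v1 v2] := hv v vQ; have [v2' v1'] := hv' v vQ.
  rewrite v1 v2; case eav: (e a v) => /=; [move=> wQ2 |].
    rewrite hW wQ2 /= esym; apply: (bic_adj esym bQ2 _ wQ2 _ evw) => //.
      by rewrite v2.
    by rewrite esym -v2' v2.
  rewrite orbF => wQ1; rewrite wQ1 /= esym.
  by apply: (bic_adj esym bQ1 _ wQ1 aQ1 evw); rewrite ?v1 ?(esym v) eav.
exists W; split=> //.
- split.
  + by apply/set0Pn; exists w0.
  + by apply/subsetP=> w; rewrite WE => /andP[].
  + rewrite -setI_eq0; apply/eqP/setP=> w; rewrite !inE.
    by apply/negP=> /andP[/andP[wQ1 eaw]]; apply/negP; case: (hw w wQ1 eaw).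
- move=> v; case: ifP => [/hQ //|/negbT vQ].
  by apply/idP/idP=> vi; [apply: h21 | apply: h12].
- move=> v v' vQ v'Q; have [-> _] := hv v vQ; have [-> _] := hv v' v'Q.
  case eav: (e a v); case eav': (e a v') => /=.
  + exact/negbTE/(bic_nadj esym bQ aQ vQ v'Q eav eav').
  + by apply: (bic_adj esym bQ aQ vQ v'Q eav); rewrite eav'.
  + by rewrite esym; apply: (bic_adj esym bQ aQ v'Q vQ eav'); rewrite eav.
  have [y yQ eay] := bic_neighbor esym bQ aQ.
  have eyv : e y v by apply: (bic_adj esym bQ aQ yQ vQ eay); rewrite eav.
  have eyv' : e y v' by apply: (bic_adj esym bQ aQ yQ v'Q eay); rewrite eav'.
  exact/negbTE/(bic_nadj esym bQ yQ vQ v'Q eyv eyv').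
- by move=> v vQ w wQ; apply: eNW.
move=> w wW n nQ; have := wW; rewrite WE => /andP[wQ1 eaw].
have [wQ wQ2 wN] := hw w wQ1 eaw.
rewrite -(eNW a n aQ nQ); apply/idP/idP => [ewn|/andP[nQ1]]; last first.
  by apply: (bic_adj esym bQ1 aQ1 wQ1 nQ1 eaw).
(* A vertex [n] adjacent to both [a] and [w] would lie in [Q1] and form a triangle there. So [a w n]
   is an induced path, and only [Q1] can contain it. *)
have ean : ~~ e a n.
  apply/negP=> ean; have /andP[nQ1 _] : (n \in Q1) && e a n.
    by rewrite -WE -(eNW a n aQ nQ).
  by have := bic_nadj esym bQ1 aQ1 wQ1 nQ1 eaw ean; rewrite ewn.
have := p3_meets oQ eaw ewn ean; rewrite aQ (negbTE nQ) (negbTE aQ2) !andbF.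
by move=> /(_ isT); rewrite /= orbF => /and3P[_ _ ->].
Qed.

(** * The case where every vertex of [Q1 :|: Q2] outside [Q] has a neighbour in [Q] *)

Section Crossing.
Variables (Q Q1 Q2 : {set T}) (a : T).
Hypotheses (oQ : only_meets e Q Q1 Q2) (aQ : a \in Q) (aQ2 : a \notin Q2).

Lemma outside_nadj z : z \notin Q -> z \notin Q1 -> ~~ e a z.
Proof.
move=> zQ zQ1; apply/negP=> eaz; have := edge_meets oQ eaz aQ zQ.
by rewrite (negbTE zQ1) (negbTE aQ2) andbF.
Qed.

Lemma crossing_nadj u z : u \notin Q -> z \notin Q -> z \notin Q1 -> e u z ->
  ~~ e a u.
Proof.
move=> uQ zQ zQ1 euz; apply/negP=> eau.
have := p3_meets oQ eau euz (outside_nadj zQ zQ1).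
by rewrite aQ (negbTE zQ1) (negbTE aQ2) (negbTE zQ) !andbF => /(_ isT).
Qed.

End Crossing.

Section NoIsolated.
Variables (Q Q1 Q2 : {set T}) (a b : T).
Hypotheses (bQ2 : is_biclique e Q2) (oQ : only_meets e Q Q1 Q2).
Hypotheses (aQ : a \in Q) (aQ2 : a \notin Q2).
Hypotheses (bQ' : b \in Q) (bQ2' : b \in Q2) (bQ1' : b \notin Q1).
Hypothesis attached : forall u, u \in Q1 :|: Q2 -> u \notin Q ->
  exists2 v, v \in Q & e u v.
Let oQ' := only_meets_sym oQ.

(** If [u z] were an edge, a neighbour [t] of [u] in [Q] would be forced to be adjacent to [z] and
    to lie in [Q1] and [Q2]. Then [u t b] is an induced path contained in none of [Q], [Q1],
    [Q2]. *)
Lemma no_exclusive_edge u z : u \in Q1 -> u \notin Q2 -> u \notin Q ->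
  z \in Q2 -> z \notin Q1 -> z \notin Q -> ~~ e u z.
Proof.
move=> uQ1 uQ2 uQ zQ2 zQ1 zQ; apply/negP=> euz.
have [t tQ eut] : exists2 v, v \in Q & e u v by apply: attached; rewrite // inE uQ1.
have etu : e t u by rewrite esym.
have eau := crossing_nadj oQ aQ aQ2 uQ zQ zQ1 euz.
have tQ1 : t \in Q1.
  by have := edge_meets oQ etu tQ uQ; rewrite (negbTE uQ2) andbF orbF => /andP[].
have ezu : e z u by rewrite esym.
have ezt : e z t.
  apply: contraT => nezt; have := p3_meets oQ ezu eut nezt.
  by rewrite tQ !orbT (negbTE uQ) (negbTE zQ1) (negbTE uQ2) !andbF => /(_ isT).
have etz : e t z by rewrite esym.
have tQ2 : t \in Q2.
  by have := edge_meets oQ etz tQ zQ; rewrite (negbTE zQ1) andbF => /andP[].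
have ebz := crossing_nadj oQ' bQ' bQ1' zQ uQ uQ2 ezu.
have ezb : ~~ e z b by rewrite esym.
have etb : e t b by apply: (bic_adj esym bQ2 zQ2 tQ2 bQ2' ezt).
have eub : ~~ e u b by rewrite esym (outside_nadj oQ').
have := p3_meets oQ eut etb eub.
by rewrite tQ !orbT (negbTE uQ) (negbTE uQ2) (negbTE bQ1') !andbF => /(_ isT).
Qed.

End NoIsolated.

(** Half of a twin argument: in [Q], the neighbours of [a] are neighbours of [u]. They are all
    adjacent to [b], and [b] and [u] are on the same side of [Q2]. *)
Lemma crossing_nested Q Q1 Q2 a b u u' z :
  is_biclique e Q -> is_biclique e Q1 -> is_biclique e Q2 ->
  only_meets e Q Q1 Q2 ->
  a \in Q -> a \in Q1 -> a \notin Q2 -> b \in Q -> b \in Q2 -> b \notin Q1 ->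
  u \in Q1 -> u \in Q2 -> u \notin Q -> u' \in Q1 -> u' \in Q2 ->
  z \in Q2 -> z \notin Q1 -> z \notin Q ->
  e u z -> ~~ e u u' -> ~~ e b u' ->
  [/\ ~~ e b u, ~~ e a b &
      {in Q, forall y, e a y -> y \in Q2 /\ e u y}].
Proof.
move=> bQ bQ1 bQ2 oQ aQ aQ1 aQ2 bQ' bQ2' bQ1' uQ1 uQ2 uQ u'Q1 u'Q2.
move=> zQ2 zQ1 zQ euz euu' ebu'.
have ebu : ~~ e b u.
  apply/negP=> ebu; have := bic_adj esym bQ2 bQ2' uQ2 u'Q2 ebu ebu'.
  by rewrite (negbTE euu').
have ebz : e b z.
  by rewrite esym; apply: (bic_adj esym bQ2 uQ2 zQ2 bQ2' euz); rewrite esym.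
have eaz := outside_nadj oQ aQ aQ2 zQ zQ1.
have eab : ~~ e a b.
  apply/negP=> eab; have := p3_meets oQ eab ebz eaz.
  by rewrite aQ (negbTE zQ) (negbTE aQ2) (negbTE bQ1') !andbF => /(_ isT).
split=> // y yQ eay.
have eyb : e y b by apply: (bic_adj esym bQ aQ yQ bQ' eay).
have yQ2 : y \in Q2.
  case eyz: (e y z).
    have := edge_meets oQ eyz yQ zQ.
    by rewrite (negbTE zQ1) andbF => /andP[].
  have := p3_meets oQ eyb ebz.
  rewrite eyz yQ (negbTE zQ) (negbTE zQ1) !andbF /= => /(_ isT isT).
  by case/andP.
split=> //; rewrite esym; have eby : e b y by rewrite esym.
exact: (bic_adj esym bQ2 bQ2' yQ2 uQ2 eby ebu).
Qed.

(** By connectedness the three bicliques cover the graph. A fourth one, [R], is disjoint from [Q]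
    and contains an edge leaving [Q1] and an edge leaving [Q2]. These make some [u] outside [Q] a
    twin of [a] over [Q], against maximality. *)
Lemma no_fourth_biclique Q Q1 Q2 a b :
  connected_graph e ->
  is_biclique e Q -> is_biclique e Q1 -> is_biclique e Q2 ->
  only_meets e Q Q1 Q2 ->
  a \in Q -> a \in Q1 -> a \notin Q2 -> b \in Q -> b \in Q2 -> b \notin Q1 ->
  (forall u, u \in Q1 :|: Q2 -> u \notin Q -> exists2 v, v \in Q & e u v) ->
  forall R, is_biclique e R -> [\/ R = Q, R = Q1 | R = Q2].
Proof.
move=> ce bQ bQ1 bQ2 oQ aQ aQ1 aQ2 bQ' bQ2' bQ1' att R bR.
have oQ' := only_meets_sym oQ.
have closedQ : closed e (mem (Q :|: (Q1 :|: Q2))).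
  apply: intro_closed => [|u z euz]; first exact: sym_connect_sym.
  rewrite !inE => uU; apply: contraT; rewrite !negb_or => /and3P[zQ zQ1 zQ2].
  have [uQ|uQ] := boolP (u \in Q).
    by have := edge_meets oQ euz uQ zQ; rewrite (negbTE zQ1) (negbTE zQ2) !andbF.
  have [|t tQ eut] := att u _ uQ; first by rewrite (negbTE uQ) in uU; rewrite inE.
  have ezu : e z u by rewrite esym.
  case ezt: (e z t).
    have etz : e t z by rewrite esym.
    by have := edge_meets oQ etz tQ zQ; rewrite (negbTE zQ1) (negbTE zQ2) !andbF.
  have := p3_meets oQ ezu eut; rewrite ezt tQ (negbTE zQ) (negbTE zQ1) (negbTE zQ2).
  by rewrite !orbT => /(_ isT isT).
have allQ v : v \in Q :|: (Q1 :|: Q2).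
  by rewrite -(closed_connect closedQ (ce a v)) inE aQ.
have [RQ|] := boolP [disjoint R & Q]; last first.
  by rewrite -setI_eq0 => /set0Pn[v /setIP[vR vQ]]; apply: oQ bR vR vQ.
have notQ v : v \in R -> v \notin Q by move=> vR; rewrite (disjointFr RQ).
have [R1|/eqP nR1] := eqVneq R Q1; first by constructor 2.
have [R2|/eqP nR2] := eqVneq R Q2; first by constructor 3.
have in12 v : v \in R -> v \notin Q1 -> v \in Q2.
  by move=> /notQ/negbTE vQ /negbTE v1; have := allQ v; rewrite !inE vQ v1.
have in21 v : v \in R -> v \notin Q2 -> v \in Q1.
  by move=> vR; apply: contraR => /(in12 v vR).
have [r1 r1R r1N] := bic_neq_sub esym bR bQ1 nR1.
have [r2 r2R r2N] := bic_neq_sub esym bR bQ2 nR2.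
have [u [z [uR zR uQ1 zQ1 euz]]] :=
  bic_crossing esym bR r2R r1R (in21 _ r2R r2N) r1N.
have [u' [z' [u'R z'R u'Q2 z'Q2 eu'z']]] :=
  bic_crossing esym bR r1R r2R (in12 _ r1R r1N) r2N.
have zQ2 := in12 z zR zQ1; have z'Q1 := in21 z' z'R z'Q2.
have excl x y : x \in R -> y \in R -> x \notin Q2 -> y \notin Q1 -> ~~ e x y.
  move=> xR yR x2 y1; apply: (no_exclusive_edge bQ2 oQ aQ aQ2 bQ' bQ2' bQ1' att);
    by [|apply: in21|apply: in12|apply: notQ].
have uQ2 : u \in Q2 by apply: contraLR euz => uQ2; apply: excl.
have u'Q1 : u' \in Q1.
  by apply: contraLR eu'z' => u'Q1; rewrite esym; apply: excl.
(* If [u] and [u'] were adjacent, [z] and [z'] would be on opposite sides of [R], giving an edge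
   excluded by [excl]. *)
have euu' : ~~ e u u'.
  apply/negP=> euu'; have := excl z' z z'R zR z'Q2 zQ1.
  have eu'z : ~~ e u' z := bic_nadj esym bR uR u'R zR euu' euz.
  have euz' : ~~ e u z'.
    by apply: (bic_nadj esym bR u'R uR z'R _ eu'z'); rewrite esym.
  by rewrite esym (bic_adj esym bR uR zR z'R euz euz').
have [uQ u'Q] := (notQ u uR, notQ u' u'R).
have [zQ z'Q] := (notQ z zR, notQ z' z'R).
have ebu' := crossing_nadj oQ' bQ' bQ1' u'Q z'Q z'Q2 eu'z'.
have eau := crossing_nadj oQ aQ aQ2 uQ zQ zQ1 euz.
have eu'u : ~~ e u' u by rewrite esym.
have [ebu eab hy] := crossing_nested bQ bQ1 bQ2 oQ aQ aQ1 aQ2 bQ' bQ2' bQ1'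
  uQ1 uQ2 uQ u'Q1 u'Q2 zQ2 zQ1 zQ euz euu' ebu'.
have [_ _ hy'] := crossing_nested bQ bQ2 bQ1 oQ' bQ' bQ2' bQ1' aQ aQ1 aQ2
  u'Q2 u'Q1 u'Q uQ2 uQ1 z'Q1 z'Q2 z'Q eu'z' eu'u eau.
have [y yQ eay] := bic_neighbor esym bQ aQ.
have eyb : e y b := bic_adj esym bQ aQ yQ bQ' eay eab.
have [yQ2 euy] := hy y yQ eay.
have [|yQ1 _] := hy' y yQ; first by rewrite esym.
(* One inclusion of neighbourhoods is [hy]. For the other, a neighbour [v] of [u] on the side of [a]
   would form a triangle with [u] and [y] inside [Q1] or [Q2]; this uses that [y] lies in both. *)
case/negP: uQ; apply: (biclique_twin esym eirr bQ aQ) => v vQ.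
case eav: (e a v); first by case: (hy v vQ eav) => _ ->.
apply/idP/idP=> // euv; have evu : e v u by rewrite esym.
have eyv : e y v by apply: (bic_adj esym bQ aQ yQ vQ eay); rewrite eav.
have := edge_meets oQ evu vQ (notQ u uR).
have eyu : e y u by rewrite esym.
case/orP=> /andP[vi _].
  by have := bic_nadj esym bQ1 yQ1 vi uQ1 eyv eyu; rewrite evu.
by have := bic_nadj esym bQ2 yQ2 vi uQ2 eyv eyu; rewrite evu.
Qed.

(** If [Q1] and [Q2] were disjoint, each would contain a vertex of [Q] together with all its
    neighbours in [Q]. Two such vertices are adjacent or have a common neighbour in [Q], and either
    way [Q1] meets [Q2]. *)
Lemma others_meet Q Q1 Q2 :
  is_biclique e Q -> is_biclique e Q1 -> is_biclique e Q2 ->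
  only_meets e Q Q1 Q2 -> Q1 <> Q -> Q2 <> Q ->
  ~~ [disjoint Q1 & Q] -> ~~ [disjoint Q2 & Q] -> ~~ [disjoint Q1 & Q2].
Proof.
move=> bQ bQ1 bQ2 oQ n1 n2 d1 d2; apply/negP=> d12.
have side P1 P2 : is_biclique e P1 -> only_meets e Q P1 P2 -> P1 <> Q ->
    ~~ [disjoint P1 & Q] -> [disjoint P1 & P2] ->
    exists v, [/\ v \in Q, v \in P1 & {in Q, forall y, e v y -> y \in P1}].
  move=> bP1 oP nP1 + d; rewrite -setI_eq0 => /set0Pn[x /setIP[xP xQ]].
  have [y yP yQ] := bic_neq_sub esym bP1 bQ nP1.
  have [v [w [vP wP vQ wQ evw]]] := bic_crossing esym bP1 xP yP xQ yQ.
  have wP2 : w \notin P2 by rewrite (disjointFr d).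
  exists v; split=> // t tQ evt; have etv : e t v by rewrite esym.
  case etw: (e t w).
    have := edge_meets oP etw tQ wQ; rewrite (negbTE wP2) andbF orbF.
    by case/andP.
  have := p3_meets oP etv evw; rewrite etw tQ (negbTE wQ) (negbTE wP2) !andbF.
  by move=> /(_ isT isT); rewrite /= orbF => /and3P[].
have [v1 [v1Q v1P h1]] := side Q1 Q2 bQ1 oQ n1 d1 d12.
rewrite disjoint_sym in d12.
have [v2 [v2Q v2P h2]] := side Q2 Q1 bQ2 (only_meets_sym oQ) n2 d2 d12.
case e12: (e v1 v2); first by have := h1 v2 v2Q e12; rewrite (disjointFr d12).
have [y yQ ey] := bic_neighbor esym bQ v1Q.
have yP1 := h1 y yQ ey.
have yP2 : y \in Q2.
  by apply: h2 => //; rewrite esym (bic_adj esym bQ v1Q yQ v2Q ey) ?e12.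
by rewrite (disjointFr d12 yP2) in yP1.
Qed.

End LocalStructure.

(** * Replacing the edges inside [Q] by one new vertex *)

Section Gadget.
Variables (T : finType) (e : rel T) (q : KBvert e) (Q1 Q2 W : {set T}) (a b w0 : T).
Hypotheses (esym : symmetric e) (eirr : irreflexive e).
Hypothesis ce : connected_graph e.
Let Q := val q.
Hypotheses (bQ1 : is_biclique e Q1) (bQ2 : is_biclique e Q2).
Hypothesis oQ : only_meets e Q Q1 Q2.
Hypotheses (aQ : a \in Q) (aQ1 : a \in Q1) (bQ : b \in Q) (bQ1' : b \notin Q1).
Hypotheses (w0W : w0 \in W) (WQ1 : W \subset Q1) (WQ : [disjoint W & Q]).
Hypothesis Q2E : forall v, (v \in Q2) = if v \in Q then v \notin Q1 else v \in Q1.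
Hypothesis eQQ : {in Q &, forall v v', e v v' = (v \in Q1) (+) (v' \in Q1)}.
Hypothesis eQn : {in Q, forall v w, w \notin Q -> e v w = (w \in W)}.
Hypothesis eWn :
  {in W, forall w n, n \notin Q -> e w n = (n \in Q1) && (n \notin W)}.

(* None is the new vertex; Q1 :\: W is X :|: U in the notation of the header. *)
Definition gadget_rel : rel (option T) := fun s t =>
  match s, t with
  | Some x, Some y => e x y && ~~ ((x \in Q) && (y \in Q))
  | Some x, None | None, Some x => (x \in Q1) && (x \notin W)
  | None, None => false
  end.

(** Once X and Y are no longer joined, [Q2] absorbs [Q] and becomes X, Y, U against W. Any other
    biclique gains the new vertex exactly when it contains [w0], an arbitrary vertex of [W] that the
    new vertex imitates. This keeps [Q1] out of the enlarged [Q2]. *)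
Definition gadget_map (B : {set T}) : {set option T} :=
  [set s | match s with
           | Some x => (x \in B) || (B == Q2) && (x \in Q)
           | None => (B != Q2) && (w0 \in B)
           end].

Let W_notQ w : w \in W -> w \notin Q.
Proof. by move=> wW; rewrite (disjointFr WQ wW). Qed.

Let w0Q1 : w0 \in Q1. Proof. exact: (subsetP WQ1). Qed.
Let w0Q : w0 \notin Q. Proof. exact: W_notQ. Qed.
Let w0Q2 : w0 \in Q2. Proof. by rewrite Q2E (negbTE w0Q). Qed.
Let bQ2' : b \in Q2. Proof. by rewrite Q2E bQ. Qed.
Let aQ2 : a \notin Q2. Proof. by rewrite Q2E aQ aQ1. Qed.
Let nQ1 : Q1 <> Q. Proof. by move=> h; move: bQ1'; rewrite h bQ. Qed.
Let nQ2 : Q2 <> Q. Proof. by move=> h; move: aQ2; rewrite h aQ. Qed.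
Let n12 : Q1 == Q2 = false.
Proof. by apply/eqP=> h; move: aQ2; rewrite -h aQ1. Qed.

Let eWE w n : w \in W -> e w n = (n \in Q) || (n \in Q1) && (n \notin W).
Proof.
move=> wW; case nQ: (n \in Q); last by rewrite eWn ?nQ.
by rewrite esym eQn ?W_notQ.
Qed.

Lemma gadget_sym : symmetric gadget_rel.
Proof. by move=> [x|] [y|] //=; rewrite esym [(y \in Q) && _]andbC. Qed.

Lemma gadget_irr : irreflexive gadget_rel.
Proof. by move=> [x|] //=; rewrite eirr. Qed.

Lemma gadget_connected : connected_graph gadget_rel.
Proof.
have cs := sym_connect_sym gadget_sym.
(* Each deleted edge inside [Q] is replaced by a walk through [w0]. *)
have cw v : v \in Q -> connect gadget_rel (Some v) (Some w0).
  by move=> vQ; apply: connect1; rewrite /= (negbTE w0Q) andbF eQn ?w0W.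
have cS x y : connect gadget_rel (Some x) (Some y).
  apply: connected_transport ce x y => x y exy.
  case xyQ: ((x \in Q) && (y \in Q)); last by rewrite connect1 //= exy xyQ.
  case/andP: xyQ => xQ yQ; apply: connect_trans (cw x xQ) _.
  by rewrite cs cw.
have aW : a \notin W by apply: contraL aQ; apply: W_notQ.
have cN x : connect gadget_rel None (Some x).
  by apply: connect_trans (connect1 _) (cS a x); rewrite /= aQ1.
by move=> [x|] [y|] //; rewrite cs.
Qed.

Let otherP B : is_biclique e B -> B <> Q ->
  [\/ B = Q1, B = Q2 | {in B, forall x, x \notin Q}].
Proof.
move=> bB nB; have [->|/eqP n1] := eqVneq B Q1; first by constructor 1.
have [->|/eqP n2] := eqVneq B Q2; first by constructor 2.
by constructor 3 => x xB; apply/negP=> xQ; case: (oQ bB xB xQ).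
Qed.

Lemma gadget_map_bisplit B : is_biclique e B -> B <> Q ->
  bisplit gadget_rel (gadget_map B).
Proof.
move=> bB nB; have [B2|nB2] := eqVneq B Q2.
  have memE s : s \in gadget_map Q2 ->
      exists2 x, s = Some x & (x \in Q2) || (x \in Q).
    by rewrite inE eqxx; case: s => // x hx; exists x.
  rewrite B2.
  (* All of [Q] collapses to [b]: in the new graph the vertices of [Q] are pairwise nonadjacent and
     their neighbours among the old vertices are exactly [W]. *)
  apply: (bisplit_pullback (h := fun s =>
    if s is Some x then if x \in Q then b else x else b)
    (biclique_bisplit esym bQ2)).
  - by move=> _ /memE[x ->]; case: ifP => // _; rewrite orbF.
  - move=> _ _ /memE[x -> _] /memE[y -> _] /=.
    case xQ: (x \in Q); case yQ: (y \in Q); rewrite ?andbT ?andbF ?eirr //=.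
    + by rewrite !eQn ?yQ.
    + by rewrite esym [RHS]esym !eQn ?xQ.
  - exists (Some b), (Some w0); rewrite !inE bQ2' w0Q2 /= (negbTE w0Q) andbF.
    by rewrite eQn ?w0W.
have BQ1 x : x \in B -> x \in Q -> x \in Q1.
  case: (otherP bB nB) => [->|h|h] //; first by rewrite h eqxx in nB2.
  by move=> /h/negbTE->.
have memS x : (Some x \in gadget_map B) = (x \in B).
  by rewrite inE (negbTE nB2) orbF.
have memN : None \in gadget_map B = (w0 \in B) by rewrite inE nB2.
have eN x : x \in B -> (x \in Q1) && (x \notin W) = e w0 x.
  move=> xB; rewrite eWE //; case xQ: (x \in Q) => //=.
  by rewrite (BQ1 x xB xQ) //=; apply: contraL xQ; apply: W_notQ.
have eS x y : x \in B -> y \in B -> gadget_rel (Some x) (Some y) = e x y.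
  move=> xB yB /=; case xQ: (x \in Q); case yQ: (y \in Q); rewrite ?andbT //=.
  by rewrite andbF eQQ // !BQ1.
(* Here [B] meets [Q] only inside [Q1], so it loses no edge, and on [B] the new vertex has the same
   neighbours as [w0]. *)
apply: (bisplit_pullback (h := fun s => if s is Some x then x else w0)
  (biclique_bisplit esym bB)).
- by move=> [x|]; rewrite ?memS ?memN.
- move=> [x|] [y|]; rewrite ?memS ?memN => xB yB; rewrite ?eS //=.
  + by rewrite eN // esym.
  + by rewrite eN.
- have [[x [y [xB yB exy]]] _] := biclique_bisplit esym bB.
  by exists (Some x), (Some y); rewrite !memS eS.
Qed.

Lemma gadget_map_sub B C : is_biclique e B -> is_biclique e C ->
  B <> Q -> C <> Q -> gadget_map B \subset gadget_map C -> B = C.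
Proof.
move=> bB bC nB nC /subsetP sBC; have [C2|nC2] := eqVneq C Q2; last first.
  apply: (biclique_sub esym bB bC); apply/subsetP=> x xB.
  by have := sBC (Some x); rewrite !inE xB (negbTE nC2) orbF; apply.
rewrite C2; case: (otherP bB nB) => [B1|//|hB].
  by have := sBC None; rewrite !inE B1 C2 n12 w0Q1 eqxx => /(_ isT).
apply: (biclique_sub esym bB bQ2); apply/subsetP=> x xB.
have := sBC (Some x); rewrite !inE xB C2 eqxx (negbTE (hB x xB)) orbF.
exact.
Qed.

(** Images can acquire a common vertex only at [None] or in the part of [Q] added to [Q2]. In both
    cases [B] and [C] already share [w0], since a biclique other than [Q] and [Q2] that meets [Q] is
    [Q1]. *)
Lemma gadget_map_disjoint B C : is_biclique e B -> is_biclique e C ->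
  B <> Q -> C <> Q -> B <> C ->
  [disjoint gadget_map B & gadget_map C] = [disjoint B & C].
Proof.
move=> bB bC nB nC nBC; apply: negb_inj; rewrite -!setI_eq0; apply/set0Pn/set0Pn.
  case=> [[x|]]; rewrite !inE; last first.
    by case/andP=> /andP[_ wB] /andP[_ wC]; exists w0; rewrite inE wB.
  have Q2x D : is_biclique e D -> D <> Q -> D <> Q2 -> x \in D -> x \in Q ->
      w0 \in D.
    by move=> bD nD nD2 xD xQ; case: (oQ bD xD xQ) => // ->.
  case/andP=> /orP[xB|/andP[/eqP B2 xQ]] /orP[xC|/andP[/eqP C2 xQ']].
  - by exists x; rewrite inE xB.
  - exists w0; rewrite inE C2 w0Q2 andbT; apply: (Q2x B) => //.
    by rewrite -C2.
  - exists w0; rewrite inE B2 w0Q2 /=; apply: (Q2x C) => //.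
    by rewrite -B2 => h; apply: nBC.
  - by case: nBC; rewrite B2 C2.
by case=> x /setIP[xB xC]; exists (Some x); rewrite !inE xB xC.
Qed.

(** Three cases: [K] meets Y and lies in the image of [Q2]; it meets [Q] only in X and lies in the
    image of [Q1]; or it avoids [Q] and its old vertices extend to a biclique of the old graph. *)
Lemma gadget_map_surj K : is_biclique gadget_rel K ->
  exists2 B, is_biclique e B /\ B <> Q & K \subset gadget_map B.
Proof.
move=> bK.
have mem2 x : (Some x \in gadget_map Q2) = (x \in Q2) || (x \in Q).
  by rewrite inE eqxx.
have mem1 x : (Some x \in gadget_map Q1) = (x \in Q1).
  by rewrite inE n12 orbF.
have memN1 : None \in gadget_map Q1 by rewrite inE n12.
have [/existsP[y /and3P[yK yQ yQ1]]|noY] :=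
  boolP [exists y, [&& Some y \in K, y \in Q & y \notin Q1]].
  exists Q2 => //; apply/subsetP=> t tK.
  have [[w|] wK eyw] := bic_neighbor gadget_sym bK yK; last first.
    by move: eyw; rewrite /= (negbTE yQ1).
  have wW : w \in W.
    move: eyw; rewrite /= yQ; case wQ: (w \in Q); first by rewrite andbF.
    by rewrite eQn ?wQ // andbT.
  have := bic_xor gadget_sym bK yK wK tK eyw; case: t tK => [t|] tK; last first.
    by rewrite /= wW (negbTE yQ1) andbF.
  rewrite mem2 /= yQ (eWE _ wW) (negbTE (W_notQ wW)) andbT /= Q2E.
  case tQ: (t \in Q); rewrite ?orbT //= andbT eQn ?tQ // orbF.
  case tW: (t \in W); last by rewrite andbT.
  by move=> _; apply: (subsetP WQ1).
have {}noY x : Some x \in K -> x \in Q -> x \in Q1.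
  move=> xK xQ; apply: contraNT noY => xQ1; apply/existsP; exists x.
  by rewrite xK xQ.
have [/existsP[x /andP[xK xQ]]|noX] := boolP [exists x, (Some x \in K) && (x \in Q)].
  have xQ1 := noY x xK xQ; exists Q1 => //; apply/subsetP=> -[t|] // tK.
  rewrite mem1; case tQ: (t \in Q); first exact: noY.
  have [s sK exs] := bic_neighbor gadget_sym bK xK.
  have := bic_xor gadget_sym bK xK sK tK exs.
  rewrite /= tQ andbF andbT eQn ?tQ //.
  case tW: (t \in W) => /=; first by move=> _; apply: (subsetP WQ1).
  case: s sK exs => [w|] wK /=; last by move=> _ /andP[].
  rewrite xQ /=; case wQ: (w \in Q); first by rewrite andbF.
  rewrite eQn ?wQ // ?tQ ?andbF ?andbT => wW.
  by rewrite eWE // tQ => /andP[].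
have {}noX x : Some x \in K -> x \notin Q.
  by move=> xK; apply: contra noX => xQ; apply/existsP; exists x; rewrite xK.
have eS x y : Some x \in K -> e x y = gadget_rel (Some x) (Some y).
  by move=> /noX/negbTE /= ->; rewrite andbT.
(* Over a set avoiding [Q], the new vertex and [w0] are twins, so [w0] can stand in for [None] in
   the old graph. *)
have w0K : None \in K -> Some w0 \in K.
  move=> NK; apply: (biclique_twin gadget_sym gadget_irr bK NK) => -[v|] vK /=.
    by rewrite eWE // (negbTE (noX v vK)) andbF andbT.
  by rewrite w0W andbF.
pose K0 := [set x | Some x \in K].
have memK x : (x \in K0) = (Some x \in K) by rewrite inE.
have [|B bB sB] := @biclique_exists _ _ esym K0.
  apply: (bisplit_pullback (h := Some) (biclique_bisplit gadget_sym bK)).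
  - by move=> x; rewrite memK.
  - by move=> x y; rewrite !memK => xK _; apply: eS.
  have [[s [t [sK tK est]]] _] := biclique_bisplit gadget_sym bK.
  case: s t sK tK est => [x|] [y|] xK yK exy //.
  - by exists x, y; rewrite !memK eS.
  - exists x, w0; rewrite !memK w0K //; split=> //.
    by rewrite esym eWE //; move: exy => /= ->; rewrite orbT.
  - exists y, w0; rewrite !memK w0K //; split=> //.
    by rewrite esym eWE //; move: exy => /= ->; rewrite orbT.
(* An extension that meets [Q] is one of [Q], [Q1], [Q2]; the vertices of these outside [Q] all
   belong to [Q1], so [Q1] can be used instead. *)
have [/existsP[x /andP[xB xQ]]|BQ] := boolP [exists x, (x \in B) && (x \in Q)].
  exists Q1 => //; apply/subsetP=> -[t|] // tK; rewrite mem1.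
  have tB : t \in B by apply: (subsetP sB); rewrite memK.
  have := noX t tK; case: (oQ bB xB xQ) tB => -> //; first by move=> ->.
  by rewrite Q2E; case: (t \in Q).
have nB x : x \in Q -> x \in B -> False.
  by move=> xQ xB; case/existsP: BQ; exists x; rewrite xB.
have nBQ : B <> Q by move=> h; apply: (nB a); rewrite ?h.
have nBQ2 : B != Q2 by apply/eqP=> h; apply: (nB b); rewrite ?h.
exists B => //; apply/subsetP=> -[t|] tK; rewrite inE.
  by rewrite (subsetP sB) ?memK.
by rewrite nBQ2 (subsetP sB) // memK w0K.
Qed.

Lemma gadget_iso : graph_iso (del_rel (KBrel e) q) (KBrel gadget_rel).
Proof.
apply: (graph_iso_biclique_map (phi := gadget_map)) gadget_sym _ _ _ _.
- by move=> B [bB nB]; apply: gadget_map_bisplit.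
- exact: gadget_map_surj.
- by move=> B C [bB nB] [bC nC]; apply: gadget_map_sub.
- by move=> B C [bB nB] [bC nC]; apply: gadget_map_disjoint.
Qed.

End Gadget.

(** * The case distinction *)

Theorem theorem2 (T : finType) (e : rel T) :
  simple_graph e -> connected_graph e ->
  forall q : KBvert e, degree (KBrel e) q = 2 ->
  exists (T' : finType) (e' : rel T'),
    simple_graph e' /\ connected_graph e' /\
    graph_iso (del_rel (KBrel e) q) (KBrel e').
Proof.
move=> [esym eirr] ce q /eqP/cards2P[q1 [q2 [neq12 qE]]].
have qP x : KBrel e q x = (x \in [set q1; q2]) by rewrite -qE inE.
have bq := valP q; have b1 := valP q1; have b2 := valP q2.
have /andP[nq1 dq1] : KBrel e q q1 by rewrite qP !inE eqxx.
have /andP[nq2 dq2] : KBrel e q q2 by rewrite qP !inE eqxx orbT.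
have n1 : val q1 <> val q by move/val_inj/eqP; rewrite eq_sym; apply/negP.
have n2 : val q2 <> val q by move/val_inj/eqP; rewrite eq_sym; apply/negP.
have n12 : val q1 <> val q2 by move/val_inj/eqP; apply/negP.
have oQ : only_meets e (val q) (val q1) (val q2).
  move=> B v bB vB vq; pose x : KBvert e := Sub B bB.
  have [->|/eqP nB] := eqVneq B (val q); first by constructor 1.
  have : KBrel e q x.
    apply/andP; split; first by apply/eqP=> h; apply: nB; rewrite h.
    by rewrite -setI_eq0; apply/set0Pn; exists v; rewrite inE vq.
  rewrite qP !inE => /orP[]/eqP/(congr1 val) <-; [constructor 2|constructor 3];
    by [].
have only2 (x y : KBvert e) : only_meets e (val q) (val x) (val y) ->
    val x <> val q -> {in val q, forall v, v \in val y -> v \in val x} ->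
    exists (T' : finType) (e' : rel T'), simple_graph e' /\ connected_graph e' /\
      graph_iso (del_rel (KBrel e) q) (KBrel e').
  move=> oxy nx sub; apply: (delete_private esym eirr ce (valP x) nx).
  move=> B v bB nB vB vq; case: (oxy B v bB vB vq) => // h; first by rewrite -h.
  by apply: sub => //; rewrite -h.
have [s21|/forall_inPn[b bqi]] := boolP [forall v in val q, (v \in val q2) ==> (v \in val q1)].
  apply: (only2 q1 q2) => // v vq; apply/implyP.
  by move/forall_inP: s21; apply.
rewrite negb_imply => /andP[bq2 bq1].
have [s12|/forall_inPn[a aqi]] := boolP [forall v in val q, (v \in val q1) ==> (v \in val q2)].
  apply: (only2 q2 q1) => //; first exact: only_meets_sym.
  by move=> v vq; apply/implyP; move/forall_inP: s12; apply.
rewrite negb_imply => /andP[aq1 aq2].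
have gadget (x y : KBvert e) c d u : only_meets e (val q) (val x) (val y) ->
    c \in val q -> c \in val x -> c \notin val y ->
    d \in val q -> d \in val y -> d \notin val x ->
    u \in val x -> u \notin val q -> {in val q, forall v, ~~ e u v} ->
    exists (T' : finType) (e' : rel T'), simple_graph e' /\ connected_graph e' /\
      graph_iso (del_rel (KBrel e) q) (KBrel e').
  move=> oxy cq cx cy dq dy dx ux uq uN.
  have [W [[/set0Pn[w wW] WQ1 WQ] Q2E eQQ eQn eWn]] :=
    isolated_structure esym eirr bq (valP x) (valP y) oxy cq cx cy dq dy dx ux uq uN.
  exists (option T), (gadget_rel q (val x) W); split; first split.
  - exact: gadget_sym.
  - exact: gadget_irr.
  - split; first exact: (gadget_connected (a := c) (w0 := w)).
    by apply: (gadget_iso (Q2 := val y) (a := c) (b := d) (w0 := w));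
      rewrite // ?(valP x) ?(valP y).
(* With [a] and [b] witnessing that neither absorption is possible, an isolated [u] gives the
   gadget, with the roles of [q1] and [q2] chosen so that [u] lies in the first. Otherwise only
   three bicliques exist. *)
have [/existsP[u /and3P[ui uq /forall_inP uN]]|att] := boolP [exists u,
  [&& u \in val q1 :|: val q2, u \notin val q & [forall v in val q, ~~ e u v]]].
  case/setUP: ui => ui; first exact: (gadget q1 q2 a b u).
  by apply: (gadget q2 q1 b a u) => //; apply: only_meets_sym.
exists 'I_4, p4_rel; split; first by split; [apply: p4_sym | apply: p4_irr].
split; first exact: p4_connected.
rewrite disjoint_sym in dq1; rewrite disjoint_sym in dq2.
apply: (two_other_bicliques esym b1 b2 n1 n2 n12).
  exact: (others_meet esym eirr bq b1 b2 oQ).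
apply: (no_fourth_biclique esym eirr ce bq b1 b2 oQ aqi aq1 aq2 bqi bq2 bq1).
move=> u ui uq; have : ~~ [forall v in val q, ~~ e u v].
  by apply: contra att => uN; apply/existsP; exists u; rewrite ui uq.
by case/forall_inPn=> v vq; rewrite negbK; exists v.
Qed.
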